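(* Let $K$ be a finite field, and let $V$ be a nonzero, finite-dimensional $K$-vector space. Then the finitary double centralizer clone $(\Sigma^V)^{\perp\perp(\aleph_0)}$ of $V$ is equal to the clone of finitary derived operations $\langle \Sigma^V \rangle_{\aleph_0}$ of $V$, where $\Sigma$ is the usual signature for $K$-vector spaces.
   Context: $\Sigma$ is the signature consisting of a binary operation symbol $+$, a constant symbol $0$, a unary operation symbol $-$, and a unary operation symbol $c$ for each $c\in K$ (scalar multiplication by $c$). $\Sigma^V$ denotes the set of the corresponding basic operations on $V$. A finitary operation on a set $A$ is a map $A^n\to A$ with $n$ a finite cardinal ($n=0$ is allowed). A finitary clone on $A$ is a set $F$ of finitary operations on $A$ that contains all projections $\pi_i:A^n\to A$ and is such that for every $f:A^m\to A$ in $F$ and all $g_1,\dots,g_m:A^n\to A$ in $F$, the composite $f\circ(g_1,\dots,g_m):A^n\to A$ lies in $F$. The clone of finitary derived operations $\langle\Sigma^V\rangle_{\aleph_0}$ is the smallest finitary clone on $V$ containing $\Sigma^V$. Operations $f:A^n\to A$ and $g:A^m\to A$ commute, written $f\perp g$, if for every matrix $a=(a_{ij})\in A^{n\times m}$ one has $g\bigl((f((a_{ij})_{i\in n}))_{j\in m}\bigr)=f\bigl((g((a_{ij})_{j\in m}))_{i\in n}\bigr)$. For a set $G$ of finitary operations on $A$, $G^{\perp(\aleph_0)}$ is the set of all finitary operations $f$ on $A$ with $f\perp g$ for all $g\in G$, and $G^{\perp\perp(\aleph_0)}$ is the result of applying $(-)^{\perp(\aleph_0)}$ twice to $G$. *)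

(* Defs.v *)
From HB Require Import structures.
From mathcomp Require Import all_boot all_order all_algebra.
From mathcomp Require Import boolp classical_sets.

Set Implicit Arguments.
Unset Strict Implicit.
Unset Printing Implicit Defensive.

Import GRing.Theory.
Local Open Scope ring_scope.

Section Clones.

Variable A : Type.

Definition op (n : nat) : Type := {ffun 'I_n -> A} -> A.

(* A set of finitary operations on A is given arity by arity. *)
Definition opset : Type := forall n, set (op n).

Definition op_proj n (i : 'I_n) : op n := fun x => x i.

Definition op_comp m n (f : op m) (g : 'I_m -> op n) : op n :=
  fun x => f [ffun i => g i x].

Record is_clone (F : opset) : Prop := IsClone {
  clone_proj : forall n (i : 'I_n), F n (op_proj i);
  clone_comp : forall m n (f : op m) (g : 'I_m -> op n),
    F m f -> (forall i, F n (g i)) -> F n (op_comp f g) }.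

(* The smallest clone containing S, as the intersection of all of them. *)
Definition generated_clone (S : opset) : opset := fun n f =>
  forall F : opset, is_clone F -> (forall k, S k `<=` F k)%classic -> F n f.

Definition op_commute n m (f : op n) (g : op m) : Prop :=
  forall a : 'M[A]_(n, m),
    g [ffun j => f [ffun i => a i j]] = f [ffun i => g [ffun j => a i j]].

Definition centralizer (G : opset) : opset := fun n f =>
  forall m (g : op m), G m g -> op_commute f g.

End Clones.

Section VectorSpaceSignature.

Variables (K : fieldType) (V : lmodType K).

Inductive vs_symbol : Type :=
| SymAdd | SymZero | SymOpp | SymScale of K.

Definition vs_arity (s : vs_symbol) : nat :=
  match s with
  | SymAdd => 2 | SymZero => 0 | SymOpp => 1 | SymScale _ => 1
  end.

Definition vs_interp (s : vs_symbol) : op V (vs_arity s) :=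
  match s return op V (vs_arity s) with
  | SymAdd => fun x => x ord0 + x ord_max
  | SymZero => fun=> 0
  | SymOpp => fun x => - x ord0
  | SymScale c => fun x => c *: x ord0
  end.

Inductive vs_ops : forall n, op V n -> Prop :=
| VsOp (s : vs_symbol) : vs_ops (@vs_interp s).

End VectorSpaceSignature.

(* Main.v *)
Require Import Defs.
From HB Require Import structures.
From mathcomp Require Import all_boot all_order all_algebra.
From mathcomp Require Import boolp classical_sets.

Set Implicit Arguments.
Unset Strict Implicit.
Unset Printing Implicit Defensive.

Import GRing.Theory.
Local Open Scope ring_scope.

(** An operation in the double centralizer commutes with every [K]-linear
    operation: with addition, so it is additive, and with the rank-one
    endomorphisms [u |-> phi u *: w].  Choosing [phi v = 1] and writing
    [x] as the sum over [i] of the images of [e_i] under [u |-> phi u *: x i],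
    where [e_i] has [v] in position [i] and [0] elsewhere, gives
    [f x = sum_i phi (f e_i) *: x i], a derived operation. *)

Section Centralizers.

Variable A : Type.

(** Lets the families to commute over be given as plain functions, without [\matrix] terms. *)
Lemma op_commuteP n m (f : op A n) (g : op A m) :
  op_commute f g <-> forall a : 'I_n -> 'I_m -> A,
    g [ffun j => f [ffun i => a i j]] = f [ffun i => g [ffun j => a i j]].
Proof.
split=> [fg a | fg a]; last exact: fg.
have := fg (\matrix_(i, j) a i j).
have -> : [ffun j => f [ffun i => (\matrix_(i, j) a i j) i j]] =
          [ffun j => f [ffun i => a i j]].
  apply/ffunP=> j; rewrite !ffunE; congr f.
  by apply/ffunP=> i; rewrite !ffunE mxE.
move=> ->; congr f; apply/ffunP=> i; rewrite !ffunE; congr g.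
by apply/ffunP=> j; rewrite !ffunE mxE.
Qed.

Lemma op_commute_sym n m (f : op A n) (g : op A m) :
  op_commute f g -> op_commute g f.
Proof. by move=> /op_commuteP fg; apply/op_commuteP=> a; rewrite fg. Qed.

Lemma sub_double_centralizer (S : opset A) n (f : op A n) :
  S n f -> centralizer (centralizer S) f.
Proof. by move=> Sf m g /(_ _ _ Sf) /op_commute_sym. Qed.

Lemma centralizer_is_clone (S : opset A) : is_clone (centralizer S).
Proof.
split=> [n i m g _ a | m n f g Cf Cg p h Sh].
  by rewrite /op_proj !ffunE; congr g; apply/ffunP=> j; rewrite !ffunE.
apply/op_commuteP=> a; rewrite /op_comp.
(* Row [i] of this matrix lists the values of [g i] on the columns of [a]; [h] first passes through
   [f], then through each [g i]. *)
have /op_commuteP/(_ (fun i j => g i [ffun k => a k j])) -> := Cf p h Sh.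
congr f; apply/ffunP=> i; rewrite !ffunE.
by have /op_commuteP-> := Cg i p h Sh.
Qed.

Lemma generated_clone_is_clone (S : opset A) : is_clone (generated_clone S).
Proof.
split=> [n i F CF _ | m n f g Sf Sg F CF SF]; first exact: clone_proj.
by apply: clone_comp => // [|i]; [apply: Sf | apply: Sg].
Qed.

Lemma sub_generated_clone (S : opset A) n (f : op A n) :
  S n f -> generated_clone S f.
Proof. by move=> Sf F _; apply. Qed.

End Centralizers.

Section VectorSpaces.

Variables (K : fieldType) (V : lmodType K).

(** Commuting with each basic operation is one clause of linearity. This supplies the test
    operations for the double centralizer. *)
Lemma linear_centralizes_vs_ops n (g : {linear {ffun 'I_n -> V} -> V}) :
  centralizer (@vs_ops K V) (g : op V n).
Proof.
move=> _ _ [[|||c]] a /=; rewrite ?ffunE.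
- by rewrite -linearD; congr (g _); apply/ffunP=> i; rewrite !ffunE.
- by rewrite -[LHS](linear0 g); congr (g _); apply/ffunP=> i; rewrite !ffunE.
- by rewrite -linearN; congr (g _); apply/ffunP=> i; rewrite !ffunE.
- by rewrite -linearZ; congr (g _); apply/ffunP=> i; rewrite !ffunE.
Qed.

Lemma linear_combination_derived n (c : 'I_n -> K) :
  generated_clone (@vs_ops K V) (fun x => \sum_i c i *: x i).
Proof.
have GC := generated_clone_is_clone (@vs_ops K V).
have GS s := sub_generated_clone (VsOp V s).
pose G := @generated_clone _ (@vs_ops K V) n.
(* Summing over an arbitrary list of indices keeps the arity [n] fixed during the induction. *)
suff Gs (r : seq 'I_n) : G (fun x => \sum_(i <- r) c i *: x i) by apply: Gs.
elim: r => [|i r IHr].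
  (* Composing the nullary zero with the empty family turns it into an [n]-ary constant. *)
  rewrite (_ : (fun _ => _) =
    op_comp (@vs_interp K V (SymZero K)) (fun i : 'I_0 => fun=> 0)).
    by apply: (clone_comp GC (GS _)) => -[].
  by apply/funext=> x; rewrite big_nil.
have Gi : G (fun x => c i *: x i).
  rewrite (_ : (fun _ => _) =
    op_comp (@vs_interp K V (SymScale (c i))) (fun=> @op_proj V n i)).
    by apply: (clone_comp GC (GS _)) => _; apply: clone_proj.
  by apply/funext=> x; rewrite /op_comp /= ffunE.
pose g (b : 'I_2) : op V n :=
  if b == ord0 then fun x => c i *: x i
  else fun x => \sum_(j <- r) c j *: x j.
rewrite (_ : (fun _ => _) = op_comp (@vs_interp K V (SymAdd K)) g).
  by apply: (clone_comp GC (GS _)) => b; rewrite /g; case: ifP.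
by apply/funext=> x; rewrite /op_comp /= !ffunE big_cons.
Qed.

End VectorSpaces.

(** A nonzero vector forms a free family by itself, and its coordinate form takes the value 1 on
    it. *)
Lemma exists_dual_vector (K : fieldType) (V : vectType K) (v : V) :
  v != 0 -> exists phi : {scalar V}, phi v = 1.
Proof.
move=> v0; have fv : free [tuple v] by rewrite seq1_free.
exists (coord [tuple v] ord0).
by have := coord_free ord0 ord0 fv; rewrite eqxx.
Qed.

Section DoubleCentralizer.

Variables (K : fieldType) (V : vectType K).

Let centralizes n (f : op V n) := centralizer (centralizer (@vs_ops K V)) f.

Lemma double_centralizer_linear n (f : op V n) m
    (g : {linear {ffun 'I_m -> V} -> V}) (a : 'I_n -> 'I_m -> V) :
    centralizes f ->
  g [ffun j => f [ffun i => a i j]] = f [ffun i => g [ffun j => a i j]].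
Proof.
by move=> Cf; have /op_commuteP-> := Cf m _ (linear_centralizes_vs_ops g).
Qed.

(** The [m]-ary sum is itself a linear operation, so [f] commutes with it; the matrix used has the
    [F j] as columns. *)
Lemma double_centralizer_sum n (f : op V n) m
    (F : 'I_m -> {ffun 'I_n -> V}) :
  centralizes f -> f (\sum_j F j) = \sum_j f (F j).
Proof.
move=> Cf; pose s (x : {ffun 'I_m -> V}) := \sum_j x j.
have s_lin : linear s.
  move=> c x y; rewrite /s scaler_sumr -big_split /=.
  by apply: eq_bigr => j _; rewrite !ffunE.
pose sL : {linear {ffun 'I_m -> V} -> V} := HB.pack s
  (GRing.isLinear.Build K {ffun 'I_m -> V} V _ s s_lin).
have := double_centralizer_linear sL (fun i j => F j i) Cf.
rewrite /= /s => E; transitivity (f [ffun i =>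
    \sum_j [ffun j => F j i] j]).
  congr f; apply/ffunP=> i; rewrite sum_ffunE ffunE.
  by apply: eq_bigr => j _; rewrite ffunE.
rewrite -E; apply: eq_bigr => j _; rewrite ffunE; congr f.
by apply/ffunP=> i; rewrite ffunE.
Qed.

Lemma double_centralizer_rank_one n (f : op V n) (phi : {scalar V}) (w : V)
    (x : {ffun 'I_n -> V}) :
  centralizes f -> f [ffun i => phi (x i) *: w] = phi (f x) *: w.
Proof.
(* The endomorphism becomes a unary operation, and [x] the single column of an [n] by 1 matrix. *)
move=> Cf; pose t (y : {ffun 'I_1 -> V}) := phi (y ord0) *: w.
have t_lin : linear t.
  by move=> c y z; rewrite /t !ffunE linearP scalerDl scalerA.
pose tL : {linear {ffun 'I_1 -> V} -> V} := HB.pack t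
  (GRing.isLinear.Build K {ffun 'I_1 -> V} V _ t t_lin).
have := double_centralizer_linear tL (fun i _ => x i) Cf.
rewrite /= /t ffunE => E; transitivity (f [ffun i =>
    phi ([ffun=> x i] (@ord0 0)) *: w]).
  by congr f; apply/ffunP=> i; rewrite !ffunE.
rewrite -E; congr (phi (f _) *: w).
by apply/ffunP=> i; rewrite ffunE.
Qed.

Lemma double_centralizer_linear_combination n (f : op V n) (v : V) :
    v != 0 -> centralizes f ->
  exists c : 'I_n -> K, f = fun x => \sum_i c i *: x i.
Proof.
move=> /exists_dual_vector[phi phi_v] Cf.
pose e i : {ffun 'I_n -> V} := [ffun j => if j == i then v else 0].
exists (fun i => phi (f (e i))); apply/funext=> x.
transitivity (f (\sum_i [ffun j => phi (e i j) *: x i])).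
  (* At position [j] only the summand [i = j] survives, with coefficient [phi v = 1]. *)
  congr f; apply/ffunP=> j; rewrite sum_ffunE (bigD1 j) //= !ffunE eqxx phi_v.
  rewrite scale1r big1 ?addr0 // => i ij.
  by rewrite !ffunE eq_sym (negPf ij) linear0 scale0r.
rewrite double_centralizer_sum //; apply: eq_bigr => i _.
exact: double_centralizer_rank_one.
Qed.

End DoubleCentralizer.

Theorem theorem7p2 (K : finFieldType) (V : vectType K)
    (hV : exists v : V, v != 0) :
  centralizer (centralizer (@vs_ops K V)) = generated_clone (@vs_ops K V).
Proof.
have [v v0] := hV; apply: functional_extensionality_dep => n.
apply/seteqP; split=> [f Cf | f]; last first.
  (* The double centralizer is a clone containing the basic operations, so it contains the smallest
     such clone. *)
  apply; first exact: centralizer_is_clone.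
  by move=> k; apply: sub_double_centralizer.
have [c ->] := double_centralizer_linear_combination v0 Cf.
exact: linear_combination_derived.
Qed.
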